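(* Let $\varphi\in\mathcal C$ and let $i\in\{2,\dots,n\}$. There exists no constant $c>0$ such that $$c\,r_i(K+_\varphi K')\ \le\ r_i(K)+r_i(K')$$ holds for all $K,K'\in\mathcal K^n_o$.
   Context: $\mathcal C$ is the class of convex, strictly increasing functions $\varphi:[0,\infty)\to[0,\infty)$ with $\varphi(0)=0$ and $\varphi(1)=1$. A convex body in $\mathbb R^n$ is a compact convex subset with nonempty interior; $\mathcal K^n_o$ is the class of convex bodies in $\mathbb R^n$ containing the origin. The support function of $K$ is $h_K(x)=\max_{y\in K}\langle x,y\rangle$. For $\varphi\in\mathcal C$ and $K,L\in\mathcal K^n_o$, the Orlicz Minkowski sum $K+_\varphi L$ is the convex body with support function $$h_{K+_\varphi L}(x)=\inf\{\lambda>0:\varphi(h_K(x)/\lambda)+\varphi(h_L(x)/\lambda)\le 1\}.$$ $\mathcal L^n_i$ is the set of $i$-dimensional linear subspaces of $\mathbb R^n$ and $L^\bot$ is the orthogonal complement of $L$. For $i=1,\dots,n$ the successive inner radius is $r_i(K)=\max_{L\in\mathcal L^n_i}\max_{x\in L^\bot}r(K\cap(x+L);x+L)$, where $r(M;x+L)$ is the inradius of $M$ taken relative to the affine subspace $x+L$; equivalently, $r_i(K)$ is the radius of the largest $i$-dimensional ball contained in $K$. *)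

(* Defs.v *)
From HB Require Import structures.
From mathcomp Require Import all_boot all_order all_algebra.
From mathcomp Require Import all_classical all_reals all_analysis.

Set Implicit Arguments.
Unset Strict Implicit.
Unset Printing Implicit Defensive.

Import Order.TTheory GRing.Theory Num.Theory.
Import numFieldNormedType.Exports.

Local Open Scope classical_set_scope.
Local Open Scope ring_scope.

(* R^n is 'rV[R]_n. The library norm on 'rV[R]_n is the max norm: it is used
   only through the topology (compactness, interior), which coincides with the
   Euclidean one; all metric notions below use the Euclidean norm [enorm]. *)

Definition dot (R : realType) (n : nat) (x y : 'rV[R]_n) : R :=
  \sum_(j < n) x ord0 j * y ord0 j.

Definition enorm (R : realType) (n : nat) (x : 'rV[R]_n) : R :=
  Num.sqrt (dot x x).

(* A function [0, +oo[ -> [0, +oo[ is represented by a total function R -> R,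
   constrained only on nonnegative arguments. *)
Definition orlicz_class (R : realType) (phi : R -> R) : Prop :=
  [/\ forall t, 0 <= t -> 0 <= phi t,
      @convex_function R R^o `[0, +oo[%classic phi,
      forall s t, 0 <= s -> s < t -> phi s < phi t,
      phi 0 = 0 &
      phi 1 = 1].

Definition convex_body (R : realType) (n : nat) (K : set 'rV[R]_n) : Prop :=
  [/\ compact K, @convex_set R 'rV[R]_n K & interior K !=set0].

Definition convex_body_origin (R : realType) (n : nat) (K : set 'rV[R]_n) :
  Prop := convex_body K /\ K 0.

(* For nonempty compact K the supremum is a maximum. *)
Definition support (R : realType) (n : nat) (K : set 'rV[R]_n)
    (x : 'rV[R]_n) : R :=
  sup [set dot x y | y in K].

Definition orlicz_support (R : realType) (n : nat) (phi : R -> R)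
    (K L : set 'rV[R]_n) (x : 'rV[R]_n) : R :=
  inf [set lambda : R | 0 < lambda /\
         phi (support K x / lambda) + phi (support L x / lambda) <= 1].

(* M = K +_phi L. A convex body is determined by its support function, so at
   most one M satisfies this. *)
Definition is_orlicz_sum (R : realType) (n : nat) (phi : R -> R)
    (K L M : set 'rV[R]_n) : Prop :=
  convex_body M /\ forall x, support M x = orlicz_support phi K L x.

Definition orthogonal_complement (R : realType) (n : nat)
    (L : {vspace 'rV[R]_n}) : set 'rV[R]_n :=
  [set x | forall y, y \in L -> dot x y = 0].

(* The affine subspace x + L. *)
Definition affine (R : realType) (n : nat) (x : 'rV[R]_n)
    (L : {vspace 'rV[R]_n}) : set 'rV[R]_n :=
  [set y | y - x \in L].

(* r(M; A): the largest radius of a ball of A contained in M, i.e. of a set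
   {y in A : |y - z| <= rho} with center z in A. It is 0 when M is empty, since
   [sup set0 = 0]. *)
Definition rel_inradius (R : realType) (n : nat) (M A : set 'rV[R]_n) : R :=
  sup [set rho : R | 0 <= rho /\
         exists2 z, A z & [set y | A y /\ enorm (y - z) <= rho] `<=` M].

(* For i >= 1 and K a convex body, every set of reals below is nonempty and
   bounded, so no default value of [sup] is involved except, harmlessly, for
   the empty sections mentioned above. *)
Definition successive_inradius (R : realType) (n i : nat)
    (K : set 'rV[R]_n) : R :=
  sup [set sup [set rel_inradius (K `&` affine x L) (affine x L)
               | x in orthogonal_complement L]
      | L in [set L : {vspace 'rV[R]_n} | (\dim L == i)%N]].

(* Main.v *)
Require Import Defs.
From mathcomp Require Import all_boot all_order all_algebra.
From mathcomp Require Import all_classical all_reals all_analysis.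
From mathcomp Require Import ring lra.

Import Order.TTheory GRing.Theory Num.Theory.
Import numFieldNormedType.Exports.
Import Defs.

Local Open Scope classical_set_scope.
Local Open Scope ring_scope.

(** The Orlicz sum can be much fatter than its summands: a body with only
    [i - 1] long directions and a body with one further long direction both have
    a tiny [i]-th inner radius, while their sum is long in [i] directions.

    Take boxes whose half-widths are [1] along a set of coordinates and [eps]
    along the others: the first i-1 coordinates for K, the i-th for K'.  An
    i-dimensional subspace always contains a nonzero vector orthogonal to the
    fewer than [i] long coordinate axes, so an i-dimensional ball inside either
    box has radius at most [n * eps] ([flat_ball_radius_le]).  On the other hand
    the Orlicz norm N(s,t) = inf {l > 0 | phi (s/l) + phi (t/l) <= 1} dominates
    s and t, hence their mean, so the Orlicz sum contains (K + K')/2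
    ([wulff_orlicz_mid]), and that set contains the i-dimensional ball of radius
    1/2 in the span of the first [i] coordinates.  Letting [eps] tend to zero
    rules out any positive constant.

    The remaining point is that K +_phi K' exists as a convex body.  It is
    realized as the Wulff shape {y | <x, y> <= h x for all x} of the Orlicz
    support function h = N (h_K, h_K').  Convexity of phi makes N, hence h,
    sublinear; and a sublinear function is the support function of its Wulff
    shape because every x admits a linear minorant of h that agrees with h at x
    ([sublinear_tangent], a finite-dimensional Hahn-Banach theorem). *)

(** * Suprema and the dot product *)

Lemma sup_le_nneg {R : realType} {E : set R} {b : R} :
  0 <= b -> (forall x, E x -> x <= b) -> sup E <= b.
Proof.
move=> b0 Eb; have [->|E0] := eqVneq E set0; first by rewrite sup0.
by apply: ge_sup => //; exact/set0P.
Qed.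

Lemma le_sup_of {R : realType} {E : set R} {b x : R} :
  (forall y, E y -> y <= b) -> E x -> x <= sup E.
Proof. by move=> Eb; apply: ub_le_sup; exists b => y /Eb. Qed.

Lemma dotDl {R : realType} {n : nat} (x y z : 'rV[R]_n) :
  dot (x + y) z = dot x z + dot y z.
Proof. by rewrite -big_split; apply: eq_bigr => j _; rewrite mxE mulrDl. Qed.

Lemma dotZl {R : realType} {n : nat} (a : R) (x y : 'rV[R]_n) :
  dot (a *: x) y = a * dot x y.
Proof. by rewrite mulr_sumr; apply: eq_bigr => j _; rewrite mxE mulrA. Qed.

Lemma dotC {R : realType} {n : nat} (x y : 'rV[R]_n) : dot x y = dot y x.
Proof. by apply: eq_bigr => j _; rewrite mulrC. Qed.

Lemma dotDr {R : realType} {n : nat} (x y z : 'rV[R]_n) :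
  dot x (y + z) = dot x y + dot x z.
Proof. by rewrite dotC dotDl !(dotC x). Qed.

Lemma dotZr {R : realType} {n : nat} (a : R) (x y : 'rV[R]_n) :
  dot x (a *: y) = a * dot x y.
Proof. by rewrite dotC dotZl dotC. Qed.

Lemma dot0r {R : realType} {n : nat} (x : 'rV[R]_n) : dot x 0 = 0.
Proof. by rewrite -[0 in LHS](scale0r 0) dotZr mul0r. Qed.

Lemma dot_delta {R : realType} {n : nat} (j : 'I_n) (y : 'rV[R]_n) :
  dot (delta_mx 0 j) y = y ord0 j.
Proof.
rewrite /dot (bigD1 j)//= big1 ?addr0 => [|k kj]; rewrite !mxE ?eqxx/=.
  by rewrite mul1r.
by rewrite (negPf kj) mul0r.
Qed.

Lemma continuous_dot {R : realType} {n : nat} (x : 'rV[R]_n) :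
  continuous (dot x : 'rV[R]_n -> R).
Proof.
apply: continuous_big => [|j _ y]; first exact: add_continuous.
by apply: continuousM; [exact: cst_continuous|exact: coord_continuous].
Qed.

(** * Sublinear functions and their linear minorants *)

Definition sublinear {R : realType} {n : nat} (h : 'rV[R]_n -> R) : Prop :=
  (forall x y, h (x + y) <= h x + h y) /\
  (forall a x, 0 <= a -> h (a *: x) = a * h x).

Lemma sublinear_of_le {R : realType} {n : nat} (h : 'rV[R]_n -> R) :
    h 0 <= 0 -> (forall x y, h (x + y) <= h x + h y) ->
    (forall a x, 0 < a -> h (a *: x) <= a * h x) ->
  sublinear h.
Proof.
move=> h0 hD hZ; split=> // a x; rewrite le_eqVlt => /predU1P[<-|a0].
  rewrite scale0r mul0r; apply/eqP; rewrite eq_le h0/=.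
  by have := hD 0 0; rewrite addr0 -subr_ge0 addrK.
apply/eqP; rewrite eq_le hZ//= -ler_pdivlMl//.
rewrite -[leLHS](_ : h (a^-1 *: (a *: x)) = _) ?hZ ?invr_gt0//.
by rewrite scalerA mulVf ?gt_eqF// scale1r.
Qed.

Section Sublinear.
Context {R : realType} {n : nat}.
Implicit Types (h g : 'rV[R]_n -> R) (x y v : 'rV[R]_n).

Lemma sublinear0 {h} : sublinear h -> h 0 = 0.
Proof. by move=> [_ hZ]; rewrite -(scale0r 0) hZ// mul0r. Qed.

Lemma sublinear_oppr_ge {h} x : sublinear h -> - h (- x) <= h x.
Proof.
move=> hs; rewrite lerNl -subr_ge0 opprK -(sublinear0 hs) -(addNr x).
exact: hs.1.
Qed.

(** One Hahn-Banach step.  The infimum of h (x + t v) - t h v over t >= 0 is the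
    largest sublinear minorant g of [h] with g (- v) <= - h v.  Since
    - g (- v) <= g v <= h v for any such g, this inequality forces
    g v = h v = - g (- v), that is, linearity along the line of [v]. *)
Lemma sublinear_flatten {h} v : sublinear h ->
  exists g, [/\ sublinear g, (forall x, g x <= h x) & g (- v) <= - h v].
Proof.
move=> hs; have [hD hZ] := hs.
pose S x := [set h (x + t *: v) - t * h v | t in [set t : R | 0 <= t]].
have S0 x : S x !=set0 by exists (h (x + 0 *: v) - 0 * h v); exists 0 => /=.
have Slb x : lbound (S x) (- h (- x)).
  move=> _ [t /= t0 <-]; rewrite -hZ// -subr_ge0 opprK addrC addrA subr_ge0.
  by apply: le_trans (hD _ _); rewrite addKr.
have Sle x t : 0 <= t -> inf (S x) <= h (x + t *: v) - t * h v.
  move=> t0; apply: ge_inf; last by exists t.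
  by exists (- h (- x)).
exists (fun x => inf (S x)); split; last 1 first.
- rewrite (le_trans (Sle _ 1 ler01))// scale1r addNr mul1r.
  by rewrite (sublinear0 hs) sub0r.
- apply: sublinear_of_le.
  + rewrite (le_trans (Sle _ 0 (lexx _)))// scale0r addr0 mul0r subr0.
    by rewrite (sublinear0 hs).
  + move=> x y; rewrite -lerBlDr; apply: lb_le_inf => // _ [s /= s0 <-].
    rewrite lerBlDl -lerBlDr; apply: lb_le_inf => // _ [t /= t0 <-].
    rewrite lerBlDr (le_trans (Sle _ (s + t) (addr_ge0 s0 t0)))//.
    have := hD (x + s *: v) (y + t *: v); rewrite addrACA -scalerDl; lra.
  + move=> a x a0; rewrite -ler_pdivrMl//.
    apply: lb_le_inf => // _ [t /= t0 <-].
    rewrite ler_pdivrMl// (le_trans (Sle _ (a * t) (mulr_ge0 (ltW a0) t0)))//.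
    by rewrite -scalerA -scalerDr hZ ?(ltW a0)// mulrBr mulrA.
- move=> x; rewrite (le_trans (Sle _ 0 (lexx _)))//.
  by rewrite scale0r addr0 mul0r subr0.
Qed.

(** Linearity along a line survives passing to a smaller sublinear function, so
    the steps for several vectors can be chained. *)
Lemma sublinear_flatten_seq {h} (s : seq 'rV[R]_n) : sublinear h ->
  exists g, [/\ sublinear g, (forall x, g x <= h x) &
                {in s, forall v, g (- v) = - g v}].
Proof.
elim: s h => [|v s IH] h hs; first by exists h.
have [k [ks kh kv]] := sublinear_flatten v hs.
have [g [gs gk gN]] := IH k ks.
exists g; split=> // [x|w]; first exact: le_trans (gk x) (kh x).
rewrite inE => /predU1P[->|/gN//].
apply/eqP; rewrite eq_le; apply/andP; split.
  by rewrite (le_trans (gk _))// (le_trans kv)// lerN2 (le_trans (gk _)).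
by rewrite lerNl sublinear_oppr_ge.
Qed.

Lemma sublinear_sum {h} {I : finType} (F : I -> 'rV[R]_n) : sublinear h ->
  h (\sum_i F i) <= \sum_i h (F i).
Proof.
move=> hs; elim/big_ind2 : _ => [|x a y b xa yb|//].
  by rewrite sublinear0.
exact: le_trans (hs.1 _ _) (lerD _ _).
Qed.

(** Flattening along [x] first pins the value at [x] for all later minorants;
    flattening along the coordinate axes next makes the minorant linear, hence
    a dot product. *)
Lemma sublinear_tangent {h} x : sublinear h ->
  exists y, (forall z, dot z y <= h z) /\ dot x y = h x.
Proof.
move=> hs; have [k [ks kh kx]] := sublinear_flatten x hs.
have [g [gs gk gN]] :=
  sublinear_flatten_seq [seq delta_mx 0 j | j : 'I_n] ks.
pose y : 'rV[R]_n := \row_j g (delta_mx 0 j).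
have gZ a j : g (a *: delta_mx 0 j) = a * g (delta_mx 0 j).
  have [a0|/ltW a0] := leP 0 a; first exact: gs.2.
  rewrite -[a]opprK scaleNr -scalerN gs.2 ?oppr_ge0// gN ?mulrN ?mulNr//.
  by rewrite map_f// mem_enum.
have g_le z : g z <= dot z y.
  rewrite [in leLHS](row_sum_delta z) (le_trans (sublinear_sum _ gs))//.
  by apply: ler_sum => j _; rewrite gZ mxE.
(* A sublinear function lying below a linear one equals it: use -z as well. *)
have gE z : dot z y = g z.
  apply/eqP; rewrite eq_le g_le andbT -[z]opprK -scaleN1r dotZl mulN1r.
  by rewrite scaleN1r (le_trans _ (sublinear_oppr_ge _ gs))// lerN2 opprK.
exists y; split=> [z|]; first by rewrite gE (le_trans (gk _)).
apply/eqP; rewrite eq_le gE (le_trans (gk _))//= -gE.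
by rewrite -[x in leRHS]opprK -scaleN1r dotZl mulN1r gE lerNr (le_trans (gk _)).
Qed.

End Sublinear.

(** * Wulff shapes and support functions *)

Definition wulff {R : realType} {n : nat} (h : 'rV[R]_n -> R) : set 'rV[R]_n :=
  [set y | forall x, dot x y <= h x].

Section Wulff.
Context {R : realType} {n : nat}.
Implicit Types (h : 'rV[R]_n -> R) (K : set 'rV[R]_n).

Lemma closed_wulff h : closed (wulff h).
Proof.
rewrite (_ : wulff h = \bigcap_x [set y | dot x y <= h x]).
  apply: closed_bigI => x _.
  apply: (@preimage_closed _ _ (dot x) [set r | r <= h x]).
    by move=> y _; exact: continuous_dot.
  exact: closed_le.
by apply/seteqP; split=> y /= yh x; [move=> _|]; exact: yh.
Qed.

Lemma compact_wulff h : compact (wulff h).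
Proof.
pose I j := `[- h (- delta_mx 0 j), h (delta_mx 0 j)].
apply: (@subclosed_compact _ _ [set y : 'rV[R]_n | forall j, y ord0 j \in I j]).
- exact: closed_wulff.
- apply: (@rV_compact R n (fun j => [set` I j])) => j.
  exact: segment_compact.
- move=> y yh j; rewrite in_itv/= -dot_delta yh lerNl -mulN1r -dotZl scaleN1r.
  by rewrite yh.
Qed.

Lemma convex_wulff h : convex_set (wulff h).
Proof.
move=> x y t; rewrite !inE => xh yh z.
have t0 : 0 <= t%:num by [].
have t1 : 0 <= 1 - t%:num by rewrite subr_ge0.
rewrite dotDr !dotZr.
apply: le_trans (lerD (ler_wpM2l t0 (xh z)) (ler_wpM2l t1 (yh z))) _.
by rewrite -mulrDl addrC subrK mul1r.
Qed.

Lemma support_wulff h : sublinear h -> support (wulff h) = h.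
Proof.
move=> hs; apply/funext => x; have [y [yh yx]] := sublinear_tangent x hs.
apply/eqP; rewrite eq_le; apply/andP; split.
  apply: ge_sup; first by exists (dot x y), y.
  by move=> _ [z zh <-].
rewrite -yx; apply: (@le_sup_of _ _ (h x)); last by exists y.
by move=> _ [z zh <-].
Qed.

Lemma dot_le_support {K} x {y} : compact K -> K y -> dot x y <= support K x.
Proof.
move=> Kc Ky; apply: ub_le_sup; last by exists y.
apply: (compact_has_sup _ _).2; first by exists (dot x y), y.
apply: continuous_compact Kc; apply: continuous_subspaceT.
exact: continuous_dot.
Qed.

Lemma support_le {K} x b : K !=set0 -> (forall y, K y -> dot x y <= b) ->
  support K x <= b.
Proof.
move=> [y Ky] Kb; apply: ge_sup; first by exists (dot x y), y.
by move=> _ [z /Kb zb <-].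
Qed.

Lemma sublinear_support K : compact K -> K !=set0 -> sublinear (support K).
Proof.
move=> Kc K0; apply: sublinear_of_le.
- by apply: support_le => // y _; rewrite dotC dot0r.
- move=> x y; apply: support_le => // z Kz.
  by rewrite dotDl lerD// dot_le_support.
- move=> a x a0; apply: support_le => // z Kz.
  by rewrite dotZl ler_pM2l// dot_le_support.
Qed.

End Wulff.

(** * The Orlicz norm of the quadrant *)

(** On nonnegative pairs this is the Luxemburg norm attached to [phi]; composed
    with the two support functions it gives [orlicz_support]. *)
Definition orlicz_norm {R : realType} (phi : R -> R) (s t : R) : R :=
  inf [set lambda | 0 < lambda /\ phi (s / lambda) + phi (t / lambda) <= 1].

Section OrliczNorm.
Context {R : realType} {phi : R -> R} (hphi : orlicz_class phi).

Lemma orlicz_class_le {s t} : 0 <= s -> s <= t -> phi s <= phi t.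
Proof.
case: hphi => _ _ phi_mono _ _ s0; rewrite le_eqVlt => /predU1P[->//|st].
exact: ltW (phi_mono _ _ _ _).
Qed.

Lemma orlicz_class_convex {a s t} : 0 <= a <= 1 -> 0 <= s -> 0 <= t ->
  phi (a * s + (1 - a) * t) <= a * phi s + (1 - a) * phi t.
Proof.
case: hphi => _ phi_convex _ _ _ /andP[a0 a1] s0 t0.
have := phi_convex (Itv01 a0 a1) s t; rewrite !inE/= !in_itv/= !andbT.
by apply.
Qed.

Lemma orlicz_class_le_id {t} : 0 <= t <= 1 -> phi t <= t.
Proof.
case: (hphi) => _ _ _ phi0 phi1 t01.
have := orlicz_class_convex t01 ler01 (lexx 0).
by rewrite phi0 phi1 !mulr0 !addr0 mulr1.
Qed.

Let adm (s t : R) : set R :=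
  [set lambda | 0 < lambda /\ phi (s / lambda) + phi (t / lambda) <= 1].

(** The convex [phi] lies below its chord on [0, 1], so for such scales l one
    has phi (s/l) + phi (t/l) <= (s + t)/l <= 1. *)
Let adm_ge_add {s t lambda} : 0 <= s -> 0 <= t -> 0 < lambda ->
  s + t <= lambda -> adm s t lambda.
Proof.
move=> s0 t0 l0 stl; split=> //.
have le1 r : 0 <= r -> r <= s + t -> phi (r / lambda) <= r / lambda.
  move=> r0 rst; rewrite orlicz_class_le_id// divr_ge0 ?(ltW l0)//=.
  by rewrite ler_pdivrMr// mul1r (le_trans rst).
apply: le_trans (lerD (le1 s _ _) (le1 t _ _)) _; rewrite ?lerDl ?lerDr//.
by rewrite -mulrDl ler_pdivrMr// mul1r.
Qed.

Let adm_neq0 {s t} : 0 <= s -> 0 <= t -> adm s t !=set0.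
Proof.
move=> s0 t0; exists (s + t + 1).
apply: adm_ge_add => //; last by rewrite lerDl.
by rewrite ltr_wpDl// addr_ge0.
Qed.

Let orlicz_norm_le {s t lambda} :
  adm s t lambda -> orlicz_norm phi s t <= lambda.
Proof. by apply: ge_inf; exists 0 => l [/ltW]. Qed.

Lemma orlicz_norm0_le0 : orlicz_norm phi 0 0 <= 0.
Proof.
apply/ler_addgt0Pl => e e0; rewrite addr0; apply: orlicz_norm_le.
by apply: adm_ge_add => //; rewrite addr0 ltW.
Qed.

Lemma orlicz_normC s t : orlicz_norm phi s t = orlicz_norm phi t s.
Proof. by congr inf; apply/seteqP; split=> l /= [l0]; rewrite addrC. Qed.

Lemma orlicz_norm_mono {s t s' t'} : 0 <= s -> s <= s' -> 0 <= t -> t <= t' ->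
  orlicz_norm phi s t <= orlicz_norm phi s' t'.
Proof.
move=> s0 ss' t0 tt'; apply: lb_le_inf => [|l [l0 hl]].
  by apply: adm_neq0; [exact: le_trans ss'|exact: le_trans tt'].
apply: orlicz_norm_le; split=> //; apply: le_trans hl.
have l0' : 0 <= l^-1 by rewrite invr_ge0 ltW.
by apply: lerD; apply: orlicz_class_le; rewrite ?mulr_ge0 ?ler_wpM2r.
Qed.

(** If l < s then phi (s/l) > phi 1 = 1, so l is not admissible. *)
Lemma orlicz_norm_ge_left {s t} : 0 <= s -> 0 <= t -> s <= orlicz_norm phi s t.
Proof.
case: (hphi) => phi_ge0 _ phi_mono _ phi1 s0 t0.
apply: lb_le_inf => [|l [l0]]; first exact: adm_neq0.
apply: contraTT; rewrite -!ltNge => ls.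
rewrite ltr_wpDr ?phi_ge0 ?divr_ge0 ?(ltW l0)//.
by rewrite -phi1 phi_mono// ltr_pdivlMr// mul1r.
Qed.

Lemma orlicz_norm_ge_mean {s t} : 0 <= s -> 0 <= t ->
  2^-1 * (s + t) <= orlicz_norm phi s t.
Proof.
move=> s0 t0; have := orlicz_norm_ge_left s0 t0.
by have := orlicz_norm_ge_left t0 s0; rewrite orlicz_normC; lra.
Qed.

Lemma orlicz_norm_scale_le {a s t} : 0 < a -> 0 <= s -> 0 <= t ->
  orlicz_norm phi (a * s) (a * t) <= a * orlicz_norm phi s t.
Proof.
move=> a0 s0 t0; rewrite -ler_pdivrMl//; apply: lb_le_inf => [|l [l0 hl]].
  exact: adm_neq0.
rewrite ler_pdivrMl//; apply: orlicz_norm_le; split; first exact: mulr_gt0.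
by rewrite -!mulf_div divff ?gt_eqF// !mul1r.
Qed.

(** If l is admissible for (s, t) and m for (s', t'), then m + l is admissible
    for the sum: (s + s')/(m + l) is the convex combination of s/l and s'/m with
    weights l/(m + l) and m/(m + l). *)
Lemma orlicz_norm_subadd {s t s' t'} : 0 <= s -> 0 <= t -> 0 <= s' -> 0 <= t' ->
  orlicz_norm phi (s + s') (t + t') <=
  orlicz_norm phi s t + orlicz_norm phi s' t'.
Proof.
move=> s0 t0 s'0 t'0.
rewrite -lerBlDr; apply: lb_le_inf => [|l [l0 hl]]; first exact: adm_neq0.
rewrite lerBlDl -lerBlDr; apply: lb_le_inf => [|m [m0 hm]].
  exact: adm_neq0.
rewrite lerBlDr; apply: orlicz_norm_le.
have lm0 : 0 < m + l by rewrite addr_gt0.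
split=> //; pose a := l / (m + l).
have a01 : 0 <= a <= 1.
  rewrite divr_ge0 ?(ltW l0) ?(ltW lm0)//= ler_pdivrMr// mul1r lerDr.
  exact: ltW.
have conv u v : 0 <= u -> 0 <= v ->
    phi ((u + v) / (m + l)) <= a * phi (u / l) + (1 - a) * phi (v / m).
  move=> u0 v0.
  rewrite (_ : (u + v) / (m + l) = a * (u / l) + (1 - a) * (v / m)).
    by apply: orlicz_class_convex => //; rewrite divr_ge0// ltW.
  by rewrite /a; field; rewrite !gt_eqF.
apply: le_trans (lerD (conv _ _ s0 s'0) (conv _ _ t0 t'0)) _.
rewrite addrACA -!mulrDr; case/andP: a01 => a0 a1.
rewrite -[leRHS](subrK a) addrC lerD//; rewrite ler_piMr// subr_ge0//.
Qed.

Lemma sublinear_orlicz_norm {n : nat} (p q : 'rV[R]_n -> R) :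
    sublinear p -> sublinear q ->
    (forall x, 0 <= p x) -> (forall x, 0 <= q x) ->
  sublinear (fun x => orlicz_norm phi (p x) (q x)).
Proof.
move=> ps qs p0 q0; apply: sublinear_of_le => [|x y|a x a0].
- by rewrite !sublinear0// orlicz_norm0_le0.
- apply: le_trans (orlicz_norm_subadd _ _ _ _) => //.
  by apply: orlicz_norm_mono; rewrite ?ps.1 ?qs.1.
- by rewrite ps.2 ?qs.2 ?(ltW a0)// orlicz_norm_scale_le.
Qed.

End OrliczNorm.

(** * Existence of the Orlicz sum *)

Section OrliczSum.
Context {R : realType} {n : nat} {phi : R -> R} (hphi : orlicz_class phi).
Context {K L : set 'rV[R]_n}.
Context (hK : convex_body_origin K) (hL : convex_body_origin L).

Let support_ge0 (M : set 'rV[R]_n) x : convex_body_origin M -> 0 <= support M x.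
Proof. by move=> [[Mc _ _] M0]; rewrite -(dot0r x) dot_le_support. Qed.

Let sublinear_support_body (M : set 'rV[R]_n) :
  convex_body_origin M -> sublinear (support M).
Proof. by move=> [[Mc _ _] M0]; apply: sublinear_support => //; exists 0. Qed.

(** The Wulff shape has interior points because it contains [K]: the Orlicz
    norm dominates its first argument. *)
Lemma is_orlicz_sum_wulff :
  is_orlicz_sum phi K L (wulff (orlicz_support phi K L)).
Proof.
split; last first.
  move=> x; rewrite support_wulff//.
  apply: (sublinear_orlicz_norm hphi); [exact: sublinear_support_body|
    exact: sublinear_support_body|by move=> z; exact: support_ge0|].
  by move=> z; exact: support_ge0.
split; [exact: compact_wulff|exact: convex_wulff|].
have [[Kc _ [u uK]] _] := hK; exists u; apply: interiorS uK => y Ky x.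
apply: le_trans (dot_le_support x Kc Ky) _.
by apply: (orlicz_norm_ge_left hphi); exact: support_ge0.
Qed.

Lemma wulff_orlicz_mid u v : K u -> L v ->
  wulff (orlicz_support phi K L) (2^-1 *: (u + v)).
Proof.
move=> Ku Lv x; rewrite dotZr dotDr.
apply: le_trans (orlicz_norm_ge_mean hphi _ _); try exact: support_ge0.
have [[Kc _ _] _] := hK; have [[Lc _ _] _] := hL.
by rewrite ler_pM2l ?invr_gt0// lerD// dot_le_support.
Qed.

End OrliczSum.

(** * Inner radii *)

Section Inradius.
Context {R : realType} {n : nat}.
Implicit Types (L : {vspace 'rV[R]_n}) (S : set 'rV[R]_n) (A : {set 'I_n}).

Lemma enorm_ge0 (x : 'rV[R]_n) : 0 <= enorm x.
Proof. exact: sqrtr_ge0. Qed.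

Lemma enormZ a (x : 'rV[R]_n) : enorm (a *: x) = `|a| * enorm x.
Proof.
by rewrite /enorm dotZl dotZr mulrA -expr2 sqrtrM ?sqr_ge0// sqrtr_sqr.
Qed.

Lemma coord_le_enorm (x : 'rV[R]_n) j : `|x ord0 j| <= enorm x.
Proof.
rewrite -sqrtr_sqr ler_wsqrtr// /dot (bigD1 j)//= -expr2 lerDl.
by apply: sumr_ge0 => k _; rewrite -expr2 sqr_ge0.
Qed.

Lemma enorm_gt0 (x : 'rV[R]_n) : x != 0 -> 0 < enorm x.
Proof.
apply: contra_neqT; rewrite -leNgt => x0; apply/rowP => j; rewrite mxE.
by apply/eqP; rewrite -normr_le0 (le_trans (coord_le_enorm _ _)).
Qed.

Lemma enorm_le_sum (x : 'rV[R]_n) : enorm x <= \sum_j `|x ord0 j|.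
Proof.
have S0 : 0 <= \sum_j `|x ord0 j| by exact: sumr_ge0.
rewrite -[leRHS](ger0_norm S0) -sqrtr_sqr ler_wsqrtr// expr2 mulr_suml.
apply: ler_sum => j _; rewrite -expr2 -real_normK ?num_real// expr2.
by rewrite ler_wpM2l// (bigD1 j)//= lerDl sumr_ge0.
Qed.

(** Restricting the coordinates in [A] to [L] is a linear map into a space of
    smaller dimension, so it has a kernel. *)
Lemma vanishing_direction L A : (#|A| < \dim L)%N ->
  exists u, [/\ u \in L, u != 0 & forall j, j \in A -> u ord0 j = 0].
Proof.
move=> AL; pose f := linfun (colsub (enum_val : 'I_#|A| -> 'I_n)
  : 'rV[R]_n -> 'rV[R]_#|A|).
have ker_gt0 : (0 < \dim (L :&: lker f))%N.
  rewrite -(ltn_add2r (\dim (f @: L))) limg_ker_dim add0n.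
  rewrite (leq_ltn_trans _ AL)//.
  by rewrite (leq_trans (dimvS (subvf _)))// dimvf /dim/= mul1n.
exists (vpick (L :&: lker f)).
have /memv_capP[uL] := memv_pick (L :&: lker f)%VS.
rewrite memv_ker lfunE/= => /eqP fu; split=> // [|j jA].
  by rewrite vpick0 -dimv_eq0 -lt0n.
have := congr1 (fun w : 'rV_#|A| => w 0 (enum_rank_in jA j)) fu.
by rewrite !mxE enum_rankK_in.
Qed.

(** The ball extends by [rho] both ways along a direction of [L] on which the
    coordinates in [A] vanish, and the width of [S] in such a direction is
    controlled by the other coordinates.  The factor [n] comes from comparing
    the Euclidean norm with the sum of the absolute coordinates. *)
Lemma flat_ball_radius_le S L A (B rho : R) z : (#|A| < \dim L)%N -> 0 <= B ->
    (forall y j, S y -> j \notin A -> `|y ord0 j| <= B) -> 0 <= rho ->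
    (forall w, w \in L -> enorm w <= rho -> S (z + w)) ->
  rho <= n%:R * B.
Proof.
move=> AL B0 SB rho0 ball.
have [u [uL u0 uA]] := vanishing_direction _ _ AL.
have nu0 := enorm_gt0 _ u0.
pose w := (rho / enorm u) *: u.
have wL : w \in L by exact: memvZ.
have wE : enorm w = rho.
  rewrite enormZ ger0_norm ?divr_ge0 ?enorm_ge0// divfK// gt_eqF//.
have wB j : `|w ord0 j| <= B.
  have [jA|jA] := boolP (j \in A); first by rewrite mxE uA// mulr0 normr0.
  have Sp : S (z + w) by apply: ball; rewrite ?wE.
  have Sm : S (z - w).
    by apply: ball; rewrite ?memvN// -scaleN1r enormZ normrN1 mul1r wE.
  move: (SB _ _ Sp jA) (SB _ _ Sm jA).
  by rewrite !mxE !ler_norml => /andP[? ?] /andP[? ?]; apply/andP; split; lra.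
rewrite -wE (le_trans (enorm_le_sum w))//.
rewrite (le_trans (ler_sum _ (fun j _ => wB j)))//.
by rewrite sumr_const card_ord mulr_natl.
Qed.

Let rel_inradius_elt_le S L A (B rho : R) x : (#|A| < \dim L)%N -> 0 <= B ->
    (forall y j, S y -> j \notin A -> `|y ord0 j| <= B) ->
    0 <= rho /\ (exists2 z, affine x L z &
      [set y | affine x L y /\ enorm (y - z) <= rho] `<=` S `&` affine x L) ->
  rho <= n%:R * B.
Proof.
move=> AL B0 SB [rho0 [z zx ball]].
apply: (flat_ball_radius_le S L A B rho z) => // w wL wr.
suff : (S `&` affine x L) (z + w) by case.
by apply: ball; rewrite /affine/= addrAC memvD//= addrAC subrr add0r.
Qed.

Lemma rel_inradius_le S L A (B : R) x : (#|A| < \dim L)%N -> 0 <= B ->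
    (forall y j, S y -> j \notin A -> `|y ord0 j| <= B) ->
  rel_inradius (S `&` affine x L) (affine x L) <= n%:R * B.
Proof.
move=> AL B0 SB; apply: sup_le_nneg => [|rho]; first by rewrite mulr_ge0.
exact: (rel_inradius_elt_le S L A B rho x).
Qed.

Lemma successive_inradius_le S A (B : R) i : (#|A| < i)%N -> 0 <= B ->
    (forall y j, S y -> j \notin A -> `|y ord0 j| <= B) ->
  successive_inradius i S <= n%:R * B.
Proof.
move=> Ai B0 SB; have nB0 : 0 <= n%:R * B by rewrite mulr_ge0.
apply: sup_le_nneg => // _ [L /= /eqP Li <-].
apply: sup_le_nneg => // _ [x _ <-].
by apply: (rel_inradius_le S L A); rewrite ?Li.
Qed.

(** Compactness of the body makes the three nested suprema defining the inner
    radius bounded, hence genuine upper bounds in [successive_inradius_ge]. *)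
Lemma compact_coord_bounded S : compact S ->
  exists B, forall y j, S y -> `|y ord0 j| <= B.
Proof.
move=> /compact_bounded[M [_ MS]]; exists (M + 1) => y j Sy.
apply: le_trans (MS _ _ y Sy); last by rewrite ltrDl.
rewrite [leRHS]/Num.norm/= mx_normrE.
by apply/bigmax_geP; right; exists (ord0, j).
Qed.

Lemma successive_inradius_ge S L (rho : R) i : compact S -> (0 < i)%N ->
    \dim L = i -> 0 <= rho ->
    (forall y, y \in L -> enorm y <= rho -> S y) ->
  rho <= successive_inradius i S.
Proof.
move=> /compact_coord_bounded[B SB] i0 Li rho0 ball.
have B0 : 0 <= B.
  have [j _] : exists j : 'I_n, True.
    have n0 : (0 < n)%N.
      rewrite (leq_trans i0)// -Li (leq_trans (dimvS (subvf _)))//.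
      by rewrite dimvf dim_matrix mul1r.
    by exists (Ordinal n0).
  apply: le_trans (SB 0 j _); first exact: normr_ge0.
  by apply: ball; rewrite ?mem0v// -(scale0r 0) enormZ normr0 mul0r.
have L0 : (#|@finset.set0 'I_n| < \dim L)%N by rewrite cards0 Li.
have le_dim (L' : {vspace 'rV[R]_n}) x : \dim L' = i ->
    rel_inradius (S `&` affine x L') (affine x L') <= n%:R * B.
  move=> L'i; apply: (rel_inradius_le S L' finset.set0); rewrite ?cards0 ?L'i//.
  by move=> y j /SB.
have nB0 : 0 <= n%:R * B by rewrite mulr_ge0.
apply: (@le_trans _ _ (rel_inradius (S `&` affine 0 L) (affine 0 L))).
  apply: (@le_sup_of _ _ (n%:R * B)) => [r rP|].
    by apply: (rel_inradius_elt_le S L finset.set0 B r 0 L0 B0 _ rP) => y j /SB.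
  split=> //; exists 0; first by rewrite /affine/= subr0 mem0v.
  move=> y [yL]; rewrite subr0 => yr; split=> //; apply: ball => //.
  by move: yL; rewrite /affine/= subr0.
apply: (@le_trans _ _ (sup [set rel_inradius (S `&` affine x L) (affine x L)
               | x in orthogonal_complement L])).
  apply: (@le_sup_of _ _ (n%:R * B)) => [_ [x _ <-]|]; first exact: le_dim.
  by exists 0 => // y _; rewrite dotC dot0r.
apply: (@le_sup_of _ _ (n%:R * B)) => [_ [L' /= /eqP L'i <-]|].
  by apply: sup_le_nneg => // _ [x _ <-]; exact: le_dim.
by exists L => //=; apply/eqP.
Qed.

End Inradius.

(** * Boxes with few long directions *)

Section Box.
Context {R : realType} {n : nat}.

Definition box (A : {set 'I_n}) (eps : R) : set 'rV[R]_n :=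
  [set y | forall j, `|y ord0 j| <= if j \in A then 1 else eps].

Lemma box_body {eps} A : 0 < eps -> convex_body_origin (box A eps).
Proof.
move=> e0; pose r j : R := if j \in A then 1 else eps.
have r0 j : 0 < r j by rewrite /r; case: ifP.
split; last by move=> j; rewrite mxE normr0 ltW// r0.
split.
- rewrite (_ : box A eps = [set y | forall j, y ord0 j \in `[- r j, r j]]).
    apply: (@rV_compact R n (fun j => [set` `[- r j, r j]])) => j.
    exact: segment_compact.
  by apply/seteqP; split=> y /= yr j; have := yr j; rewrite in_itv/= -ler_norml.
- move=> x y t; rewrite !inE => xr yr j; rewrite !mxE.
  have -> : (if j \in A then 1 else eps) = t%:num * r j + (1 - t%:num) * r j.
    by rewrite -mulrDl addrC subrK mul1r.
  rewrite (le_trans (ler_normD _ _))// !normrM lerD//.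
    by rewrite ger0_norm// ler_wpM2l// xr.
  have t1 : 0 <= 1 - t%:num by rewrite subr_ge0.
  by rewrite (ger0_norm t1); exact: ler_wpM2l.
- exists 0; apply/nbhs_ballP; exists (Num.min 1 eps) => /=.
    by rewrite lt_min ltr01 e0.
  move=> y [_ /= yb] j; have := yb ord0 j.
  rewrite /ball/= mxE sub0r normrN lt_min.
  by case/andP => y1 ye; case: ifP; rewrite ltW.
Qed.

End Box.

Lemma coordinate_subspace {R : realType} {n i : nat} : (i <= n)%N ->
  exists L : {vspace 'rV[R]_n}, \dim L = i /\
    forall y (j : 'I_n), y \in L -> (i <= j)%N -> y ord0 j = 0.
Proof.
move=> le_in.
pose f := linfun (mulmxr (pid_mx i : 'M[R]_(i, n)) : 'rV[R]_i -> 'rV[R]_n).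
exists (f @: fullv)%VS; split.
  rewrite limg_dim_eq ?dimvf ?dim_matrix ?mul1r//.
  apply/eqP; rewrite -subv0; apply/subvP => w /memv_capP[_].
  rewrite memv_ker lfunE/= memv0 => /eqP w0.
  have := congr1 (mulmxr (pid_mx i : 'M[R]_(n, i))) w0.
  by rewrite /= mul0mx -mulmxA pid_mx_id// pid_mx_1 mulmx1 => ->.
move=> _ j /memv_imgP[w _ ->] ij; rewrite lfunE/= mxE big1// => k _.
by rewrite mxE (ltn_eqF (leq_trans (ltn_ord k) ij)) mulr0.
Qed.

Lemma card_ord_lt_le (n m : nat) : (#|[set j : 'I_n | (j < m)%N]%SET| <= m)%N.
Proof.
rewrite cardE -(size_map val) -[leqRHS](size_iota 0).
apply: uniq_leq_size; first by rewrite (map_inj_uniq val_inj) enum_uniq.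
by move=> _ /mapP[j + ->]; rewrite mem_enum inE mem_iota.
Qed.

Lemma box_inradius_le {R : realType} {n : nat} (A : {set 'I_n}) (eps : R) i :
  0 <= eps -> (#|A| < i)%N -> successive_inradius i (box A eps) <= n%:R * eps.
Proof.
move=> e0 Ai; apply: (successive_inradius_le _ A) => // y j yb /negPf jA.
by have := yb j; rewrite jA.
Qed.

(** A vector y of norm at most 1/2 in the span of the first i coordinates is the
    mean of the vector of its first i-1 doubled coordinates, which lies in the
    first box, and of its doubled i-th coordinate, which lies in the second. *)
Lemma orlicz_sum_box_inradius_ge {R : realType} {n i : nat} (phi : R -> R)
    (j0 : 'I_n) (eps : R) :
    orlicz_class phi -> 0 < eps -> i.-1 = j0 -> (0 < i)%N ->
  2^-1 <= successive_inradius i (wulff (orlicz_support phi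
    (box [set j : 'I_n | (j < i.-1)%N]%SET eps) (box [set j0]%SET eps))).
Proof.
move=> hphi e0 ij i0.
have le_in : (i <= n)%N by rewrite -(prednK i0) ij.
have [L [Li L0]] := coordinate_subspace (R := R) le_in.
apply: (successive_inradius_ge _ L) => //; first exact: compact_wulff.
move=> y yL yle.
have y1 j : `|2 * y ord0 j| <= 1.
  rewrite normrM ger0_norm// -ler_pdivlMl// mulr1.
  exact: le_trans (coord_le_enorm _ _) _.
pose u : 'rV[R]_n := \row_j if (j < i.-1)%N then 2 * y ord0 j else 0.
pose v : 'rV[R]_n := \row_j if j == j0 then 2 * y ord0 j else 0.
have -> : y = 2^-1 *: (u + v).
  apply/rowP => j; rewrite !mxE ij -val_eqE/=; case: ltngtP => [_|jj|_].
  - by rewrite addr0 mulKf.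
  - by rewrite L0 ?addr0 ?mulr0// -(prednK i0) ij.
  - by rewrite add0r mulKf.
apply: (wulff_orlicz_mid hphi); [exact: box_body|exact: box_body| |];
  by move=> j; rewrite mxE inE; case: ifP => // _; rewrite normr0 ltW.
Qed.

Theorem proposition0p4 (R : realType) (n i : nat) (phi : R -> R)
    (hphi : orlicz_class phi) (hi : (2 <= i <= n)%N) :
  ~ exists c : R, 0 < c /\
      forall K K' M : set 'rV[R]_n,
        convex_body_origin K -> convex_body_origin K' ->
        is_orlicz_sum phi K K' M ->
        c * successive_inradius i M
          <= successive_inradius i K + successive_inradius i K'.
Proof.
move=> [c [c0 hc]]; case/andP: hi => i2 le_in.
have i0 : (0 < i)%N := ltnW i2.
have lt_in : (i.-1 < n)%N by rewrite prednK.
have n0 : 0 < n%:R :> R by rewrite ltr0n (leq_trans i0).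
pose j0 := Ordinal lt_in.
(* Any eps with 2 * n * eps < c / 2 would do. *)
pose eps : R := c / (8 * n%:R).
have e0 : 0 < eps by rewrite divr_gt0// mulr_gt0.
have neps : n%:R * eps = c / 8.
  by rewrite /eps; field; rewrite gt_eqF.
pose A := [set j : 'I_n | (j < i.-1)%N]%SET.
have bA := box_body A e0.
have bj := box_body [set j0]%SET e0.
have := hc _ _ _ bA bj (is_orlicz_sum_wulff hphi bA bj).
have := orlicz_sum_box_inradius_ge phi j0 eps hphi e0 erefl i0.
rewrite -/A -(ler_pM2l c0) => ge_half.
have Ai : (#|A| < i)%N.
  by rewrite (leq_ltn_trans (card_ord_lt_le _ _))// prednK.
have ji : (#|[set j0]%SET| < i)%N by rewrite cards1.
have := box_inradius_le A eps i (ltW e0) Ai.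
have := box_inradius_le [set j0]%SET eps i (ltW e0) ji.
by rewrite neps; lra.
Qed.
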